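(* The dual coproduct on a sash $C\in\Sigma_n$ is given by $$m_S^*(C)=\sum_{i=-1}^{n}C_i\otimes C^{\,n-i-1},$$ where $C_i\in\Sigma_i$ is the sash identical to the first $i$ positions of $C$, except that if position $i$ of $C$ is the left half of a rectangle then $C_i$ ends with a black square; $C^{\,n-i-1}\in\Sigma_{n-i-1}$ is the sash identical to the last $n-i-1$ positions of $C$, except that if position $i+2$ of $C$ is the right half of a rectangle then $C^{\,n-i-1}$ begins with a white square; $C_0=C^0$ is the sash of length $0$; and $C_{-1}=C^{-1}=\emptyset$ is the formal sash of length $-1$.
   Context: A sash of length $m\ge 0$ is a tiling of a $1\times m$ rectangle by black $1\times1$ squares, white $1\times1$ squares and white $1\times2$ rectangles; positions are numbered $1,\dots,m$ from left to right, and a rectangle occupies two consecutive positions, its left half and its right half. There is one sash of length $0$, and in addition a formal sash of length $-1$, denoted $\emptyset$. $\Sigma_m$ is the set of sashes of length $m$. $S_n$ is the set of permutations of $[n]=\{1,\dots,n\}$ in one-line notation ($S_0$ contains only the empty permutation $\emptyset$). A Pell permutation is $x\in S_n$ such that $x_i-x_{i+1}\le 2$ for all $i$, and whenever $x_i=x_{i+1}+2$ the value $x_{i+1}+1$ appears to the right of $x_{i+1}$; $P_n$ is the set of Pell permutations in $S_n$. The map $\sigma:S_n\to\Sigma_{n-1}$: position $i$ ($1\le i\le n-1$) of $\sigma(x)$ is a black square if $i+1$ is to the right of $i$ in $x$, and a white square if $i+1$ is to the left of $i$, except that if $i+1$ is to the right of $i$ and $i+2$ is to the left of $i$ then a rectangle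 occupies positions $i$ and $i+1$; $\sigma(\emptyset)=\emptyset$ and $\sigma(1)$ is the sash of length $0$. Restricted to $P_n$, $\sigma$ is a bijection onto $\Sigma_{n-1}$; its inverse is denoted $\eta$. Dual coproduct: let $\mathbb K$ be a field and extend $\sigma,\eta$ linearly. For $z\in S_N$, $m^*(z)=\sum_{i=0}^{N}z|_{\{1,\dots,i\}}\otimes\mathrm{st}\big(z|_{\{i+1,\dots,N\}}\big)$, where $z|_T$ is the subword of $z$ on the values in $T$ and $\mathrm{st}$ replaces the entries of a word by $1,2,\dots$ preserving relative order. For a sash $C$, $m_S^*(C)=(\sigma\otimes\sigma)\big(m^*(\eta(C))\big)$. *)

(* Defs.v *)
From HB Require Import structures.
From mathcomp Require Import all_boot all_order all_algebra finmap.
From mathcomp Require Import zify.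
From mathcomp.multinomials Require Import monalg.

Set Implicit Arguments.
Unset Strict Implicit.
Unset Printing Implicit Defensive.

Import Order.TTheory GRing.Theory Num.Theory.

Local Open Scope ring_scope.

Record oneline := OneLine {
  word :> seq nat;
  oneline_perm : perm_eq word (iota 1 (size word)) }.

HB.instance Definition _ := [isSub for word].
HB.instance Definition _ := [Choice of oneline by <:].

Definition S_ (n : nat) : {pred oneline} := [pred x : oneline | size x == n].

Definition empty_oneline : oneline := @OneLine [::] isT.

(* The members of S_ N, listed: see mem_onelines. *)
Definition onelines (N : nat) : seq oneline :=
  pmap insub (permutations (iota 1 N)).

Lemma mem_onelines N (x : oneline) : (x \in onelines N) = (x \in S_ N).
Proof.
rewrite mem_pmap_sub mem_permutations inE.
apply/idP/eqP => [/perm_size|<-]; first by rewrite size_iota.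
exact: oneline_perm.
Qed.

Lemma oneline_uniq (x : oneline) : uniq x.
Proof. by rewrite (perm_uniq (oneline_perm x)) iota_uniq. Qed.

(* a stands to the left of b in the word w *)
Definition before (w : seq nat) (a b : nat) : bool :=
  [&& a \in w, b \in w & index a w < index b w]%N.

(* Words are indexed from 0 by nth, so the paper's x_i is nth 0 x i.-1. *)
Definition is_Pell (x : oneline) : bool :=
  [forall i : 'I_(size x).-1,
     let a := nth 0%N x i in let b := nth 0%N x i.+1 in
     (a <= b + 2)%N && ((a == b + 2)%N ==> before x b b.+1)].

(* z|_{1..i} *)
Lemma restrict_le_subproof (z : oneline) (i : nat) :
  perm_eq [seq a <- z | a <= i]%N (iota 1 (size [seq a <- z | a <= i]%N)).
Proof.
set w := filter _ _; have Hw : perm_eq w (iota 1 (minn i (size z))).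
  apply: uniq_perm; rewrite ?iota_uniq ?filter_uniq ?oneline_uniq // => a.
  rewrite mem_filter (perm_mem (oneline_perm z)) !mem_iota; lia.
by rewrite (perm_size Hw) size_iota.
Qed.

Definition restrict_le (z : oneline) (i : nat) : oneline :=
  OneLine (restrict_le_subproof z i).

(* Standardization of a word without repetitions: every letter is replaced by *)
(* its rank among the letters of the word.                                    *)
Definition std (w : seq nat) : seq nat :=
  [seq (count (fun b => b < a)%N w).+1 | a <- w].

Lemma std_subproof (w : seq nat) :
  uniq w -> perm_eq (std w) (iota 1 (size (std w))).
Proof.
move=> Uw; have Lc a : a \in w -> (count (fun b => b < a) w < size w)%N.
  move=> aw; rewrite -(count_predC (fun b => b < a)%N w) -addn1 leq_add2l.
  by rewrite -has_count; apply/hasP; exists a => //=; rewrite ltnn.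
have Mono a a' : a \in w -> (a < a')%N ->
    (count (fun b => b < a) w < count (fun b => b < a') w)%N.
  move=> aw lt_aa'.
  have -> : count (fun b => b < a')%N w = (count (fun b => b < a)%N w
            + count (fun b => a <= b < a')%N w)%N.
    rewrite -count_predUI addnC (@eq_count _ (predI _ _) pred0) ?count_pred0.
      by apply: eq_count => b /=; lia.
    by move=> b /=; lia.
  rewrite -[X in (X < _)%N]addn0 ltn_add2l -has_count.
  by apply/hasP; exists a => //=; rewrite leqnn.
have Us : uniq (std w).
  rewrite map_inj_in_uniq // => a a' aw a'w [] E.
  by case: (ltngtP a a') => // /Mono; [move/(_ aw)|move/(_ a'w)]; rewrite E ltnn.
apply: uniq_perm; rewrite ?iota_uniq //.
apply: (@uniq_min_size _ _ _ Us _ _).2 => [b /mapP[a aw ->]|].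
  by rewrite mem_iota size_map; have := Lc a aw; lia.
by rewrite size_iota.
Qed.

(* st (z|_{i+1..N}) *)
Definition restrict_gt_std (z : oneline) (i : nat) : oneline :=
  OneLine (std_subproof (filter_uniq (fun a => i < a)%N (oneline_uniq z))).

Inductive tile := Black | White | Rect.

Definition tile_code (t : tile) : option bool :=
  match t with Black => Some true | White => Some false | Rect => None end.
Definition tile_decode (c : option bool) : tile :=
  match c with Some true => Black | Some false => White | None => Rect end.
Lemma tile_codeK : cancel tile_code tile_decode. Proof. by case. Qed.
HB.instance Definition _ := Choice.copy tile (can_type tile_codeK).

(* None is the formal sash of length -1; Some [::] is the sash of length 0. *)
Definition sash : Type := option (seq tile).
HB.instance Definition _ := Choice.on sash.

Definition tile_width (t : tile) : nat := if t is Rect then 2 else 1.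
Definition width (s : seq tile) : nat := sumn [seq tile_width t | t <- s].

Definition sash_length (C : sash) : int :=
  if C is Some s then (width s)%:Z else -1.

Definition Sigma_ (m : int) : {pred sash} := [pred C : sash | sash_length C == m].

(* The first k positions of a tiling, a rectangle cut in its middle leaving a *)
(* black square.                                                              *)
Fixpoint take_positions (k : nat) (s : seq tile) : seq tile :=
  match k, s with
  | k'.+1, Rect :: s' =>
      if k' is k''.+1 then Rect :: take_positions k'' s' else [:: Black]
  | k'.+1, t :: s' => t :: take_positions k' s'
  | _, _ => [::]
  end.

(* All positions of a tiling but the first k, a rectangle cut in its middle   *)
(* leaving a white square.                                                    *)
Fixpoint drop_positions (k : nat) (s : seq tile) : seq tile :=
  match k, s with
  | k'.+1, Rect :: s' =>
      if k' is k''.+1 then drop_positions k'' s' else White :: s'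
  | k'.+1, _ :: s' => drop_positions k' s'
  | _, _ => s
  end.

(* C_i for -1 <= i <= sash_length C *)
Definition first_positions (C : sash) (i : int) : sash :=
  match C, i with
  | Some s, Posz k => Some (take_positions k s)
  | _, _ => None
  end.

(* C^p for -1 <= p <= sash_length C *)
Definition last_positions (C : sash) (p : int) : sash :=
  match C, p with
  | Some s, Posz k => Some (drop_positions (width s - k)%N s)
  | _, _ => None
  end.

(* The tiles of sigma(x) covering the k positions i, ..., i+k-1.  The value   *)
(* i+2 occurs in x only if position i is not the last one, which is why       *)
(* k = 1 admits no rectangle.                                                 *)
Fixpoint sigma_tiles (x : seq nat) (i k : nat) : seq tile :=
  match k with
  | 0 => [::]
  | k'.+1 =>
      if before x i i.+1 then
        match k' with
        | 0 => [:: Black]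
        | k''.+1 => if before x i.+2 i then Rect :: sigma_tiles x i.+2 k''
                    else Black :: sigma_tiles x i.+1 k'
        end
      else White :: sigma_tiles x i.+1 k'
  end.

Definition sigma (x : oneline) : sash :=
  if size x is n'.+1 then Some (sigma_tiles x 1 n') else None.

(* The Pell permutation with image C under sigma; the default value of head   *)
(* is never reached, since sigma is a bijection from Pell permutations of     *)
(* size m+1 to sashes of length m.                                            *)
Definition eta (C : sash) : oneline :=
  head empty_oneline
    [seq x <- onelines `|(sash_length C + 1)%R|%N | is_Pell x && (sigma x == C)].

(* The lemmas cells_take, cells_drop and cells_sigma check the recursions on  *)
(* tiles above against descriptions of each position by a black square, a     *)
(* white square or half of a rectangle.                                       *)

Inductive cell := BlackCell | WhiteCell | LeftHalf | RightHalf.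

Definition tile_cells (t : tile) : seq cell :=
  match t with
  | Black => [:: BlackCell]
  | White => [:: WhiteCell]
  | Rect => [:: LeftHalf; RightHalf]
  end.
Definition cells (s : seq tile) : seq cell := flatten [seq tile_cells t | t <- s].

Definition is_left (c : cell) : bool := if c is LeftHalf then true else false.
Definition is_right (c : cell) : bool := if c is RightHalf then true else false.

Lemma size_cells s : size (cells s) = width s.
Proof. by elim: s => // -[] s /= IH; rewrite /width /= -/(width _) -IH. Qed.

Lemma cells_inj : injective cells.
Proof.
by elim=> [|[] s IH] [|[] s'] //= [] /IH ->.
Qed.

Lemma tiles_ind2 (P : nat -> seq tile -> Prop) :
  (forall s, P 0 s) -> (forall k, P k.+1 [::]) ->
  (forall k s, P k s -> P k.+1 (Black :: s)) ->
  (forall k s, P k s -> P k.+1 (White :: s)) ->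
  (forall s, P 1 (Rect :: s)) ->
  (forall k s, P k s -> P k.+2 (Rect :: s)) -> forall k s, P k s.
Proof.
move=> H0 Hn HB HW HR HRR k s; elim: s k => [|[] s IH] [|[|k]] //; auto.
Qed.

Lemma cells_take k s :
  cells (take_positions k s) =
  if is_left (last BlackCell (take k (cells s)))
  then rcons (take k.-1 (cells s)) BlackCell else take k (cells s).
Proof.
have aux t k' l : ~~ is_left t ->
    (if is_left (last BlackCell (take k'.+1 (t :: l)))
     then rcons (take k' (t :: l)) BlackCell else take k'.+1 (t :: l)) =
    t :: (if is_left (last BlackCell (take k' l))
          then rcons (take k'.-1 l) BlackCell else take k' l).
  by case: k' l t => [|k'] [|d l] [] //=; case: ifP.
move: k s; apply: tiles_ind2 => [s|//|k s IH|k s IH|//|k s IH].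
- by rewrite take0.
- by rewrite -[cells (Black :: s)]/(BlackCell :: cells s) aux // -IH.
- by rewrite -[cells (White :: s)]/(WhiteCell :: cells s) aux // -IH.
rewrite -[LHS]/[:: LeftHalf, RightHalf & cells (take_positions k s)] IH.
rewrite -[cells (Rect :: s)]/[:: LeftHalf, RightHalf & cells s].
by case: k {IH} (cells s) => [|k] [|d l] //=; case: ifP.
Qed.

Lemma cells_drop k s :
  cells (drop_positions k s) =
  if is_right (nth BlackCell (cells s) k) then WhiteCell :: drop k.+1 (cells s)
  else drop k (cells s).
Proof.
move: k s; apply: tiles_ind2 => //= s; last by rewrite drop0.
by rewrite drop0; case: s => [|[]].
Qed.

Definition left_half (x : seq nat) (i : nat) : bool :=
  before x i i.+1 && before x i.+2 i.

Definition sigma_cell (x : seq nat) (i : nat) : cell :=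
  if left_half x i then LeftHalf
  else if (1 < i)%N && left_half x i.-1 then RightHalf
  else if before x i i.+1 then BlackCell else WhiteCell.

Lemma left_half_consecutive x i : left_half x i -> left_half x i.+1 = false.
Proof. rewrite /left_half /before; lia. Qed.

Lemma cells_sigma (x : oneline) n : size x = n.+1 ->
  cells (sigma_tiles x 1 n) = [seq sigma_cell x i | i <- iota 1 n].
Proof.
suff gen m k i : (k < m)%N -> (0 < i)%N ->
    ~~ ((1 < i)%N && left_half x i.-1) -> (i + k)%N = size x ->
    cells (sigma_tiles x i k) = [seq sigma_cell x j | j <- iota i k].
  by move=> Sx; apply: (gen n.+1) => //; rewrite Sx.
elim: m k i => // m IH [|k] i // lt_km i_gt0 nL Sik.
rewrite [sigma_tiles _ _ _]/= [iota _ _]/= map_cons {1}/sigma_cell (negPf nL).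
case Bi: (before x i i.+1); last first.
  rewrite /left_half Bi /= -IH //; try lia.
  by rewrite /= /left_half Bi andbF.
case: k lt_km Sik => [|k] lt_km Sik /=.
  suff -> : left_half x i = false by [].
  rewrite /left_half [before x i.+2 i]/before (perm_mem (oneline_perm x) i.+2).
  rewrite mem_iota; lia.
rewrite /left_half Bi /=; case Li: (before x i.+2 i) => /=.
  have L : left_half x i by rewrite /left_half Bi Li.
  have -> : sigma_cell x i.+1 = RightHalf.
    rewrite /sigma_cell left_half_consecutive //= L andbT.
    by rewrite ltnS i_gt0.
  rewrite -IH //=; try lia. by rewrite left_half_consecutive ?andbF.
rewrite -[_ :: map _ _]/(map _ (iota i.+1 k.+1)) -IH //=; try lia.
by rewrite /left_half Li !andbF.
Qed.

Lemma sigma_Sigma (x : oneline) n : x \in S_ n -> sigma x \in Sigma_ (n%:Z - 1).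
Proof.
rewrite !inE /sigma => /eqP <-; case Sx: (size x) => [|m] //.
rewrite /sash_length -size_cells (cells_sigma Sx) size_map size_iota; lia.
Qed.

Lemma first_positions_Sigma (C : sash) (n i : int) :
  C \in Sigma_ n -> -1 <= i <= n -> first_positions C i \in Sigma_ i.
Proof.
rewrite !inE; case: C i => [s|] [k|k] /=; try lia.
rewrite -!size_cells cells_take => /eqP <- le_k.
case: ifP => [|_]; last by rewrite size_takel //; lia.
by case: k le_k => [|k] le_k; rewrite ?take0 // size_rcons size_takel /=; lia.
Qed.

Lemma last_positions_Sigma (C : sash) (n p : int) :
  C \in Sigma_ n -> -1 <= p <= n -> last_positions C p \in Sigma_ p.
Proof.
rewrite !inE; case: C p => [s|] [k|k] /=; try lia.
rewrite -!size_cells cells_drop => /eqP <- le_k.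
case: ifP => [|_]; last by rewrite size_drop; lia.
case: (ltnP (size (cells s) - k) (size (cells s))) => [lt_k _|ge_k].
  by rewrite /= size_drop; lia.
by rewrite nth_default.
Qed.

(* For a choiceType T, {malg K[T]} is the K-vector space                      *)
(* with basis T, the basis vector of t being << t >>, and {malg K[T * U]} is  *)
(* the tensor product of {malg K[T]} and {malg K[U]}, << (t, u) >> being the  *)
(* tensor product of << t >> and << u >>.                                     *)

Section Linear.
Variable K : fieldType.

Definition linear_extension (T : choiceType) (V : lmodType K) (f : T -> V)
    (v : {malg K[T]}) : V :=
  \sum_(t <- msupp v) v@_t *: f t.

Lemma linear_extensionU (T : choiceType) (V : lmodType K) (f : T -> V) (t : T) :
  linear_extension f << t >> = f t.
Proof.
by rewrite /linear_extension msuppU oner_eq0 big_seq_fset1 mcoeffUU scale1r.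
Qed.

Lemma linear_extension_is_linear (T : choiceType) (V : lmodType K) (f : T -> V) :
  linear (linear_extension f).
Proof.
have ext (d : {fset T}) (v : {malg K[T]}) : (msupp v `<=` d)%fset ->
    linear_extension f v = \sum_(t <- d) v@_t *: f t.
  move=> le_d; apply: big_fset_incl => // t _ /mcoeff_outdom ->.
  by rewrite scale0r.
move=> a u v; set d := (msupp u `|` msupp v `|` msupp (a *: u + v))%fset.
have su : (msupp u `<=` d)%fset by rewrite /d -fsetUA fsubsetUl.
have sv : (msupp v `<=` d)%fset by rewrite /d fsetUAC fsubsetUr.
have sw : (msupp (a *: u + v) `<=` d)%fset by rewrite fsubsetUr.
rewrite (ext d _ su) (ext d _ sv) (ext d _ sw) scaler_sumr -big_split /=.
by apply: eq_bigr => t _; rewrite mcoeffD mcoeffZ scalerDl scalerA.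
Qed.

Definition tensor (T U : choiceType) (v : {malg K[T]}) (w : {malg K[U]}) :
    {malg K[(T * U)%type]} :=
  linear_extension
    (fun t => linear_extension (fun u => << (t, u) >> : {malg K[(T * U)%type]}) w)
    v.

Lemma tensorU (T U : choiceType) (t : T) (u : U) :
  tensor << t >> << u >> = << (t, u) >>.
Proof. by rewrite /tensor !linear_extensionU. Qed.

Definition tensor_map (T T' U U' : choiceType)
    (f : {malg K[T]} -> {malg K[T']}) (g : {malg K[U]} -> {malg K[U']}) :
    {malg K[(T * U)%type]} -> {malg K[(T' * U')%type]} :=
  linear_extension (fun p => tensor (f << p.1 >>) (g << p.2 >>)).

Definition sigma_lin : {malg K[oneline]} -> {malg K[sash]} :=
  linear_extension (fun x => << sigma x >>).

Definition eta_lin : {malg K[sash]} -> {malg K[oneline]} :=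
  linear_extension (fun C => << eta C >>).

(* m^* *)
Definition dual_coproduct :
    {malg K[oneline]} -> {malg K[(oneline * oneline)%type]} :=
  linear_extension (fun z : oneline =>
    \sum_(0 <= i < (size z).+1)
       tensor << restrict_le z i >> << restrict_gt_std z i >>).

(* m_S^* *)
Definition sash_dual_coproduct (v : {malg K[sash]}) :
    {malg K[(sash * sash)%type]} :=
  tensor_map sigma_lin sigma_lin (dual_coproduct (eta_lin v)).

End Linear.

Notation "v ⊗ w" := (tensor v w) (at level 40, left associativity) : ring_scope.

(* Main.v *)
From HB Require Import structures.
From mathcomp Require Import all_boot all_order all_algebra.
From mathcomp Require Import zify.
From mathcomp.multinomials Require Import monalg.
Require Import Defs.

(**
The formula holds with any permutation z such that sigma z = C in place of
eta C.  Indeed a tile of C that starts at position i depends only on the order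
in which the letters i, i+1 and i+2 occur in z, and neither passing to a subword
nor standardizing changes the relative order of the letters that remain.
So sigma (z|_{1..i}) agrees with C up to position i-1, except that position i-1 can no longer see the letter i+1: if it
was the left half of a rectangle, then i-1 comes before i and it becomes a black
square.  Dually, if position i+1 of C is the right half of a rectangle, then the
letters i, i+1, i+2 occur in z in the order i+2, i, i+1; once i is removed, i+2
still precedes i+1, and the position turns white.  Both facts hold tile by tile,
by induction on the recursion that computes sigma: sigma_tiles_take,
sigma_tiles_drop and sigma_tiles_shift, assembled in sigma_restrict_le and
sigma_restrict_gt_std.

It remains to see that eta C is such a z, that is, that every sash is the image
of a Pell permutation (sigma_Pell_surj).  For the formal sash it is the empty one;
otherwise it is built from the permutation 1 by reading the tiles of C from left to right, each of them
adding one or two letters to a permutation of size N: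
- for a black square, N+1 goes to the end;
- for a white square, N+1 goes immediately to the left of N;
- for a rectangle, N+1 goes to the end and N+2 immediately to the left of N.
The only new descents are from N+1 to N and from N+2 to N, and in the latter
case N+1 is to the right of N, as the Pell condition requires.  No earlier tile
changes: only the one at position N-1 could, by becoming the left half of a
rectangle, but a letter N+1 at the end is not to the left of N-1, and one next
to N is on the same side of N-1 as N is.
*)

Set Implicit Arguments.
Unset Strict Implicit.
Unset Printing Implicit Defensive.

Import GRing.Theory.

Local Open Scope ring_scope.

(** * The order of the letters in a subword *)

Section Words.
Local Open Scope nat_scope.

Lemma before_cons c w a b :
  before (c :: w) a b = (b != c) && (if a == c then b \in w else before w a b).
Proof.
rewrite /before !inE /= ![c == _]eq_sym.
case: (b =P c) => [->|_] /=; first by rewrite ltn0 !andbF.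
by case: (a =P c) => [->|_] /=; rewrite ?ltnS ?andbT.
Qed.

Lemma before_total w a b :
  a \in w -> b \in w -> a != b -> before w b a = ~~ before w a b.
Proof.
move=> aw bw nab; rewrite /before aw bw /=.
have: index a w != index b w.
  by apply: contra nab => /eqP /(index_inj a aw) ->.
lia.
Qed.

Lemma before_filter P w a b :
  before (filter P w) a b = [&& P a, P b & before w a b].
Proof.
elim: w => [|c w IH] /=; first by rewrite /before !andbF.
case: ifP => Pc; rewrite !before_cons ?mem_filter IH.
  case: (b =P c) => [->|_]; first by rewrite !andbF.
  by case: (a =P c) => [->|_] /=; rewrite ?Pc.
case: (b =P c) => [->|_]; first by rewrite Pc !andbF.
by case: (a =P c) => [->|_] /=; rewrite ?Pc.
Qed.

Lemma before_map (f : nat -> nat) w a b :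
  injective f -> before (map f w) (f a) (f b) = before w a b.
Proof. by move=> fI; rewrite /before !(mem_map fI) !(index_map fI). Qed.

End Words.

(** * Cutting a permutation and cutting its sash *)

Section Sigma.
Local Open Scope nat_scope.

(** Among the first k positions, only the last one is affected by the loss of the
letters beyond i + k: on the last position sigma_tiles never asks for a
rectangle, and take_positions puts a black square in its place. *)
Lemma sigma_tiles_take x x' i k m :
    (forall a b, a <= i + k -> b <= i + k -> before x' a b = before x a b) ->
  k <= m -> sigma_tiles x' i k = take_positions k (sigma_tiles x i m).
Proof.
have [l lt_km] := ubnP m.
elim: l i k m lt_km => // l IH i [|k] m lt_ml Exx' le_km.
  by case: (sigma_tiles x i m).
case: m lt_ml le_km => // m lt_ml le_km /=.
rewrite Exx'; try lia.
case: ifP => _; last by congr (_ :: _);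
  apply: IH => [|a b *|]; rewrite ?Exx'; lia.
case: m k lt_ml le_km Exx' => [|m] [|k] // lt_ml le_km Exx'.
  by case: ifP => //=; case: (sigma_tiles _ _ _).
rewrite Exx'; try lia.
case: ifP => _; congr (_ :: _); apply: IH => [|a b *|]; rewrite ?Exx'; lia.
Qed.

(** When the cut falls inside a rectangle at i, the computation restarted at i + 1
meets i + 2 to the left of i, which is to the left of i + 1, hence gives a white
square, and then goes on from i + 2 as after the rectangle. *)
Lemma sigma_tiles_drop x i k m :
  k <= m -> sigma_tiles x (i + k) (m - k) = drop_positions k (sigma_tiles x i m).
Proof.
have [l lt_km] := ubnP m.
elim: l i k m lt_km => // l IH i [|k] m lt_ml le_km.
  by rewrite addn0 subn0; case: (sigma_tiles x i m).
case: m lt_ml le_km => // m lt_ml le_km.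
rewrite subSS -addSnnS /=.
have [B1|_] := ifP; last by apply: IH; lia.
case: m lt_ml le_km => [|m] lt_ml le_km; first by case: k le_km.
have [B2|_] := ifP; last by apply: IH; lia.
case: k le_km => [|k] le_km; last by rewrite subSS -addSnnS; apply: IH; lia.
rewrite addn0 subn0 /=.
(* B1 and B2 put the letters in the order i + 2, i, i + 1. *)
suff -> : before x i.+1 i.+2 = false by [].
by move: B1 B2; rewrite /before; lia.
Qed.

Lemma sigma_tiles_shift x x' i j k :
    (forall a b, i <= a -> i <= b -> before x' a b = before x (j + a) (j + b)) ->
  sigma_tiles x' i k = sigma_tiles x (j + i) k.
Proof.
have [l lt_kl] := ubnP k.
elim: l i k lt_kl => // l IH i [|k] lt_kl Exx' //=.
rewrite Exx' ?addnS //.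
case: ifP => _; last by rewrite IH ?addnS // => a b *; apply: Exx'; lia.
case: k lt_kl => [|k] lt_kl //; rewrite Exx' ?addnS //; last by lia.
by case: ifP => _; rewrite IH ?addnS //; try lia; move=> a b *; apply: Exx'; lia.
Qed.

Lemma mem_oneline (x : oneline) a : (a \in word x) = (0 < a <= size x).
Proof. by rewrite (perm_mem (oneline_perm x)) mem_iota; lia. Qed.

Lemma size_restrict_le (z : oneline) i :
  i <= size z -> size (restrict_le z i) = i.
Proof.
move=> le_iz; rewrite -[RHS](size_iota 1); apply/perm_size/uniq_perm.
- exact: oneline_uniq.
- exact: iota_uniq.
by move=> a; rewrite mem_filter mem_oneline mem_iota; lia.
Qed.

Lemma perm_filter_gt (z : oneline) i :
  perm_eq [seq a <- z | i < a] (iota i.+1 (size z - i)).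
Proof.
apply: uniq_perm; rewrite ?iota_uniq ?filter_uniq ?oneline_uniq // => a.
by rewrite mem_filter mem_oneline mem_iota; lia.
Qed.

Lemma size_restrict_gt_std (z : oneline) i :
  size (restrict_gt_std z i) = size z - i.
Proof. by rewrite size_map (perm_size (perm_filter_gt z i)) size_iota. Qed.

(** The letters above i are i + 1, ..., size z, so that the rank of a among them
is a - i.  Stating this with addition makes the relabelling an injection of nat,
to which before_map applies. *)
Lemma restrict_gt_stdK (z : oneline) i :
  map (addn i) (std [seq a <- z | i < a]) = [seq a <- z | i < a].
Proof.
rewrite /std -map_comp -[RHS]map_id; apply/eq_in_map => a.
rewrite mem_filter mem_oneline => /and3P[lt_ia a_gt0 le_az] /=.
rewrite (permP (perm_filter_gt z i)).
(* The letters above i are split into those below a and those from a on. *)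
have -> : size z - i = (a - i.+1) + (size z - a).+1 by lia.
rewrite iotaD count_cat.
have /eqP -> : count (fun b => b < a) (iota i.+1 (a - i.+1)) == a - i.+1.
  rewrite -{2}[a - _](size_iota i.+1) -all_count.
  by apply/allP => b; rewrite mem_iota; lia.
rewrite (@eq_in_count _ _ pred0) ?count_pred0; first lia.
by move=> b; rewrite mem_iota /=; lia.
Qed.

Lemma sigma_restrict_le (z : oneline) i :
  i <= size z ->
  sigma (restrict_le z i) = first_positions (sigma z) (i%:Z - 1)%R.
Proof.
move=> le_iz; rewrite /sigma size_restrict_le //.
case: i le_iz => [|k] le_kz; first by case: (size z).
case Sz: (size z) le_kz => [|m] // le_km.
have -> : (k.+1%:Z - 1)%R = k by lia.
congr Some; apply: sigma_tiles_take => // a b le_a le_b.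
by rewrite before_filter; move: le_a le_b; rewrite add1n => -> ->.
Qed.

Lemma width_sigma_tiles (z : oneline) m :
  size z = m.+1 -> width (sigma_tiles z 1 m) = m.
Proof. by move=> Sz; rewrite -size_cells cells_sigma // size_map size_iota. Qed.

Lemma sigma_restrict_gt_std (z : oneline) i :
  i <= size z ->
  sigma (restrict_gt_std z i) =
  last_positions (sigma z) ((size z)%:Z - 1 - i%:Z)%R.
Proof.
move=> le_iz; rewrite /sigma size_restrict_gt_std.
case Sz: (size z) le_iz => [|m] //.
rewrite leq_eqVlt => /predU1P[->|le_im].
  by rewrite subnn; have -> : (m.+1%:Z - 1 - m.+1%:Z)%R = Negz 0 by lia.
have -> : (m.+1%:Z - 1 - i%:Z)%R = (m - i) by lia.
rewrite subSn //= width_sigma_tiles //; congr Some.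
rewrite subKn // -sigma_tiles_drop // [1 + i]addnC; apply: sigma_tiles_shift.
move=> a b a_gt0 b_gt0; rewrite -(before_map _ _ _ (@addnI i)) restrict_gt_stdK.
by rewrite before_filter; case: before; lia.
Qed.

End Sigma.

(** * Every sash comes from a Pell permutation *)

Section Surjectivity.
Local Open Scope nat_scope.

(** When n does not occur in w, the letter m lands at the end; appending and
inserting to the left of n are thus two cases of one operation. *)
Fixpoint insert_before m n (w : seq nat) : seq nat :=
  if w is c :: w' then
    if c == n then m :: w else c :: insert_before m n w'
  else [:: m].

Lemma perm_insert_before m n w : perm_eq (insert_before m n w) (m :: w).
Proof.
elim: w => //= c w IH; case: ifP => // _.
apply: (@perm_trans _ [:: c, m & w]); first by rewrite perm_cons.
by apply/permP => P /=; lia.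
Qed.

Lemma before_insert_old m n w a b :
  a != m -> b != m -> before (insert_before m n w) a b = before w a b.
Proof.
move=> am bm; elim: w => [|c w IH] /=.
  by rewrite before_cons (negPf am) /before andbF.
case: ifP => _; first by rewrite before_cons (negPf am) bm.
by rewrite !before_cons IH (perm_mem (perm_insert_before m n w)) inE (negPf bm).
Qed.

(** The new letter is adjacent to n, so the letters to its left are those to the
left of n. *)
Lemma before_insert_new m n w a : m \notin w -> a != m ->
  before (insert_before m n w) a m =
  if n \in w then before w a n else a \in w.
Proof.
move=> + am; elim: w => [|c w IH] /=.
  by rewrite before_cons eqxx.
rewrite !inE negb_or => /andP[mc mw].
case: (c =P n) => [->|/eqP cn]; first by rewrite !before_cons !eqxx.
rewrite !before_cons mc [n == c]eq_sym (negPf cn) /= IH //.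
rewrite (perm_mem (perm_insert_before m n w)) inE eqxx.
by case: (a =P c) => _ //=; case: ifP.
Qed.

Lemma insert_max_subproof (x : oneline) n :
  let w := insert_before (size x).+1 n x in perm_eq w (iota 1 (size w)).
Proof.
have P := perm_insert_before (size x).+1 n x.
rewrite /= (perm_size P) (perm_trans P) //= -[1 :: _]/(iota 1 (size x).+1).
rewrite -addn1 iotaD /= cats1 perm_sym perm_rcons addn1 add1n perm_cons.
by rewrite perm_sym oneline_perm.
Qed.

(** As 0 is not a letter of x, insert_max x 0 appends the new maximum to x. *)
Definition insert_max (x : oneline) n : oneline :=
  OneLine (insert_max_subproof x n).

Lemma size_insert_max x n : size (insert_max x n) = (size x).+1.
Proof. by rewrite (perm_size (perm_insert_before _ _ _)). Qed.

Lemma before_insert_max_old (x : oneline) n a b :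
  a <= size x -> b <= size x -> before (insert_max x n) a b = before x a b.
Proof. by move=> *; apply: before_insert_old; lia. Qed.

(** The case distinction of before_insert_new as an implication: the premise says
that n occurs in x. *)
Lemma before_insert_max_new (x : oneline) n a :
  0 < a <= size x ->
  before (insert_max x n) a (size x).+1 =
  (0 < n <= size x) ==> before x a n.
Proof.
move=> Ha; rewrite before_insert_new ?mem_oneline; try lia.
by case: ifP => //=; rewrite Ha.
Qed.

Lemma before_insert_max_newl (x : oneline) n a :
  0 < a <= size x ->
  before (insert_max x n) (size x).+1 a =
  (0 < n <= size x) && ~~ before x a n.
Proof.
move=> Ha; rewrite (@before_total _ a) ?mem_oneline ?size_insert_max; try lia.
by rewrite before_insert_max_new // negb_imply.
Qed.

(** The word x stays fixed while the pair runs over the adjacent letters of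
another word: this makes the Pell condition an instance of sorted, whose
relation can be changed separately from the word it is tested on. *)
Definition Pell_step (x : seq nat) : rel nat :=
  fun a b => (a <= b + 2) && ((a == b + 2) ==> before x b b.+1).

Lemma is_PellE (x : oneline) : is_Pell x = sorted (Pell_step x) x.
Proof.
apply/forallP/(sortedP 0) => [H i lt_i | H i].
  have lt_i' : i < (size x).-1 by lia.
  exact: (H (Ordinal lt_i')).
by apply: (H i); case: i => i /=; lia.
Qed.

Lemma path_insert_before (r : rel nat) c m n w :
    {in c :: w, forall a, r a m} -> (n \in w -> r m n) ->
  path r c w -> path r c (insert_before m n w).
Proof.
elim: w c => [|d w IH] c rm mn /=; first by rewrite rm ?mem_head.
case/andP=> rcd pw; case: (d =P n) => [En|_] /=.
  by rewrite rm ?mem_head //= pw En mn // inE En eqxx.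
rewrite rcd; apply: IH => // [a aw|nw]; first by apply: rm; rewrite inE aw orbT.
by apply: mn; rewrite inE nw orbT.
Qed.

Lemma sorted_insert_before (r : rel nat) m n w :
    {in w, forall a, r a m} -> (n \in w -> r m n) ->
  sorted r w -> sorted r (insert_before m n w).
Proof.
case: w => [|c w] //= rm mn pw; case: (c =P n) => [En|_] /=.
  by rewrite pw En mn // inE En eqxx.
by apply: path_insert_before => // nw; apply: mn; rewrite inE nw orbT.
Qed.

(** The new pair ending in the maximum is an ascent, so only the step from the
maximum to n has to be checked. *)
Lemma Pell_insert_max (x : oneline) n : is_Pell x ->
    (0 < n <= size x -> Pell_step (insert_max x n) (size x).+1 n) ->
  is_Pell (insert_max x n).
Proof.
rewrite !is_PellE => Px step; apply: sorted_insert_before.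
- by move=> c; rewrite mem_oneline /Pell_step; lia.
- by rewrite mem_oneline.
apply: (@sub_in_sorted _ (mem (word x))) Px; last exact/allP.
move=> a b /=; rewrite !mem_oneline /Pell_step => Ha Hb /andP[-> H] /=.
apply/implyP => E; rewrite E /= in H.
by rewrite before_insert_max_old //; lia.
Qed.

Lemma left_half_out (x : oneline) i : size x <= i.+1 -> left_half x i = false.
Proof.
by move=> le_xi; rewrite /left_half /before (mem_oneline x i.+2); lia.
Qed.

(** The cell at i looks at the letters up to i + 2.  The new maximum is among them
only if i = size x - 1, where it could start a rectangle. *)
Lemma sigma_cell_insert_max (x : oneline) n i : 0 < i < size x ->
    (i.+1 = size x -> left_half (insert_max x n) i = false) ->
  sigma_cell (insert_max x n) i = sigma_cell x i.
Proof.
move=> Hi Hmax.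
have Ei : left_half (insert_max x n) i = left_half x i.
  have [lt_i|ge_i] := ltnP i.+1 (size x).
    by rewrite /left_half !before_insert_max_old //; lia.
  by rewrite Hmax ?left_half_out; lia.
rewrite /sigma_cell Ei before_insert_max_old; try lia.
case: i Hi {Hmax Ei} => [|[|i]] Hi //=.
by rewrite /left_half !before_insert_max_old //; lia.
Qed.

Lemma left_half_append (x : oneline) i : 0 < i <= size x ->
  i.+1 = size x -> left_half (insert_max x 0) i = false.
Proof.
by move=> Hi Ei; rewrite /left_half Ei before_insert_max_newl ?andbF; lia.
Qed.

Lemma sigma_cell_append_max (x : oneline) : 0 < size x ->
  sigma_cell (insert_max x 0) (size x) = BlackCell.
Proof.
move=> x_gt0; rewrite /sigma_cell left_half_out ?size_insert_max //=.
rewrite before_insert_max_new ?x_gt0 ?leqnn //=.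
by case: ltnP => //= lt1; rewrite left_half_append //; lia.
Qed.

(** With i + 2 immediately to the left of i + 1, the letter i cannot stand between
them, as the left half of a rectangle at i would require. *)
Lemma left_half_insert_before_max (x : oneline) i : 0 < i ->
  i.+1 = size x -> left_half (insert_max x (size x)) i = false.
Proof.
move=> i_gt0 Ei; rewrite /left_half Ei before_insert_max_newl; last by lia.
by rewrite before_insert_max_old; try lia; case: before => //; rewrite andbF.
Qed.

Lemma sigma_cell_insert_before_max (x : oneline) : 0 < size x ->
  sigma_cell (insert_max x (size x)) (size x) = WhiteCell.
Proof.
move=> x_gt0; rewrite /sigma_cell left_half_out ?size_insert_max //=.
rewrite before_insert_max_new ?x_gt0 ?leqnn //= /before ltnn !andbF.
by case: ltnP => //= lt1; rewrite left_half_insert_before_max //; lia.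
Qed.

Lemma cells_rcons s t : cells (rcons s t) = cells s ++ tile_cells t.
Proof. by rewrite /cells map_rcons flatten_rcons. Qed.

(** Working with cells rather than tiles lets the induction add tiles on the
right, whereas sigma_tiles consumes them from the left. *)
Lemma Pell_cells s : exists x : oneline,
  [/\ size x = (width s).+1, is_Pell x &
      cells s = [seq sigma_cell x i | i <- iota 1 (width s)]].
Proof.
elim/last_ind: s => [|s t [x [Sx Px Cx]]].
  exists (@OneLine [:: 1] isT); split=> //.
  by apply/forallP => -[].
have {Cx} Cx y t' : size y = (size x + tile_width t').-1.+1 ->
    (forall i, 0 < i < size x -> sigma_cell y i = sigma_cell x i) ->
    tile_cells t' = [seq sigma_cell y i | i <- iota (size x) (tile_width t')] ->
    cells (rcons s t') = [seq sigma_cell y i | i <- iota 1 (width (rcons s t'))].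
  move=> Sy Ey Et; rewrite cells_rcons -[width _]size_cells cells_rcons size_cat.
  rewrite size_cells iotaD map_cat add1n -Sx Cx; congr (_ ++ _).
    by apply/eq_in_map => i; rewrite mem_iota => Hi; rewrite Ey //; lia.
  by rewrite Et size_map size_iota.
have Wt : width (rcons s t) = width s + tile_width t.
  by rewrite -!size_cells cells_rcons size_cat; case: (t).
have x_gt0 : 0 < size x by lia.
have old0 i : 0 < i < size x -> sigma_cell (insert_max x 0) i = sigma_cell x i.
  by move=> Hi; apply: sigma_cell_insert_max => // Ei;
    apply: left_half_append; lia.
have P0 : is_Pell (insert_max x 0) by apply: Pell_insert_max.
case: t Wt => Wt.
- exists (insert_max x 0); split=> //.
    by rewrite size_insert_max Wt Sx addn1.
  apply: Cx => //; first by rewrite size_insert_max addn1.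
  by rewrite -[RHS]/[:: sigma_cell (insert_max x 0) _] sigma_cell_append_max.
- exists (insert_max x (size x)).
  split; first by rewrite size_insert_max Wt Sx addn1.
    by apply: Pell_insert_max => // _; rewrite /Pell_step; lia.
  apply: Cx; first by rewrite size_insert_max addn1.
    move=> i Hi; apply: sigma_cell_insert_max => // Ei.
    by apply: left_half_insert_before_max; lia.
  rewrite -[RHS]/[:: sigma_cell (insert_max x (size x)) _].
  by rewrite sigma_cell_insert_before_max.
(* y has N + 1 at the end, and z moreover has N + 2 just before N = size x. *)
- have [y Ey] : {y | y = insert_max x 0} by eexists.
  have Sy : size y = (size x).+1 by rewrite Ey size_insert_max.
  rewrite -Ey in P0.
  have [z Ez] : {z | z = insert_max y (size x)} by eexists.
  have Sz : size z = (size x).+2 by rewrite Ez size_insert_max Sy.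
  have Bz : before z (size x) (size x).+1.
    rewrite Ez before_insert_max_old ?Sy // Ey before_insert_max_new //; lia.
  have Lz : left_half z (size x).
    rewrite /left_half Bz -{1}Sy Ez before_insert_max_newl; last by lia.
    by rewrite /before ltnn !andbF andbT; lia.
  exists z; split; first by rewrite Sz Wt Sx addn2.
    by rewrite Ez; apply: Pell_insert_max => // _; rewrite -Ez /Pell_step Bz; lia.
  apply: Cx => /=; first by lia.
    by move=> i Hi; rewrite -old0 // -Ey Ez sigma_cell_insert_max //; lia.
  rewrite {1}/sigma_cell Lz /sigma_cell left_half_consecutive //= Lz andbT.
  by rewrite ltnS x_gt0.
Qed.

Lemma sigma_Pell_surj (C : sash) : exists2 x, is_Pell x & sigma x = C.
Proof.
case: C => [s|]; last by exists empty_oneline => //; apply/forallP => -[].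
have [x [Sx Px Cx]] := Pell_cells s; exists x => //.
rewrite /sigma Sx; congr Some; apply: cells_inj.
by rewrite (cells_sigma Sx).
Qed.

Lemma sash_length_sigma (x : oneline) :
  sash_length (sigma x) = ((size x)%:Z - 1)%R.
Proof. by apply/eqP/(@sigma_Sigma x (size x)); rewrite inE. Qed.

(** The sequence filtered in eta is nonempty by surjectivity, so its head is one
of its members, and all of these are sent to C. *)
Lemma sigma_eta (C : sash) : sigma (eta C) = C.
Proof.
have [x Px Cx] := sigma_Pell_surj C; rewrite /eta.
set l := filter _ _; suff: head empty_oneline l \in l.
  by rewrite mem_filter => /andP[/andP[_ /eqP]].
have: x \in l.
  rewrite mem_filter Px Cx eqxx mem_onelines inE -Cx sash_length_sigma /=; lia.
by case: l => // a l _; rewrite mem_head.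
Qed.

End Surjectivity.

(** * The coproduct on basis vectors *)

Lemma linear_extension_sum (K : fieldType) (T : choiceType) (V : lmodType K)
    (f : T -> V) (I : Type) (r : seq I) (F : I -> {malg K[T]}) :
  linear_extension f (\sum_(i <- r) F i) =
  \sum_(i <- r) linear_extension f (F i).
Proof.
pose L := GRing.isLinear.Build _ _ _ _ _ (linear_extension_is_linear f).
pose g : {linear {malg K[T]} -> V} := HB.pack (linear_extension f) L.
exact: (raddf_sum g).
Qed.

Lemma sash_dual_coproductU (K : fieldType) (C : sash) :
  sash_dual_coproduct (<< C >> : {malg K[sash]}) =
  \sum_(0 <= i < (size (eta C)).+1)
     << sigma (restrict_le (eta C) i) >> ⊗
     << sigma (restrict_gt_std (eta C) i) >>.
Proof.
rewrite /sash_dual_coproduct /eta_lin /dual_coproduct !linear_extensionU.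
rewrite /tensor_map linear_extension_sum; apply: eq_bigr => i _.
by rewrite [in LHS]tensorU linear_extensionU /sigma_lin !linear_extensionU.
Qed.

(* The index i runs over -1, 0, ..., n as i = j - 1 with 0 <= j <= n + 1. *)
Theorem proposition3p3 (K : fieldType) (n : int) (C : sash) (hC : C \in Sigma_ n) :
  sash_dual_coproduct (<< C >> : {malg K[sash]}) =
  \sum_(0 <= j < `|(n + 2)%R|%N)
     let i : int := j%:Z - 1 in
     (<< first_positions C i >> : {malg K[sash]})
       ⊗ (<< last_positions C (n - i - 1) >> : {malg K[sash]}).
Proof.
have Sn : n = (size (eta C))%:Z - 1.
  by rewrite -sash_length_sigma sigma_eta; move: hC; rewrite inE => /eqP.
rewrite sash_dual_coproductU Sn.
have -> : `|((size (eta C))%:Z - 1 + 2)%R|%N = (size (eta C)).+1 by lia.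
apply: eq_big_nat => j /andP[_ le_j].
rewrite (sigma_restrict_le le_j) (sigma_restrict_gt_std le_j) sigma_eta.
cbv zeta.
rewrite [in RHS](_ : _ - 1 - _ - 1 = (size (eta C))%:Z - 1 - j%:Z) //; lia.
Qed.
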